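(* Let $\mathcal U$ be a universal Martin-Löf test. If $\mathcal A\subseteq 2^\omega$ is $\Delta^0_2$, then $\chi_{\mathcal A}\restriction\mathrm{MLR}\le_{\mathrm W}\mathsf{LAY}_{\mathcal U}$.
   Context: Cantor space $2^\omega$, Lebesgue measure $\lambda$. A Martin-Löf (ML) test is a sequence $(\mathcal V_i)_{i\in\omega}$ of open subsets of $2^\omega$ such that $\{\langle i,\sigma\rangle:[\sigma]\subseteq\mathcal V_i\}$ is c.e. and $\lambda(\mathcal V_i)\le 2^{-i}$; it is universal if $\bigcap_i\mathcal V'_i\subseteq\bigcap_i\mathcal V_i$ for every ML-test $\mathcal V'$. $\mathrm{MLR}$ is the set of Martin-Löf random sequences. A set $\mathcal A\subseteq 2^\omega$ is $\Sigma^0_2$ if $\mathcal A=\bigcup_i[T_i]$ for a uniformly computable sequence of trees $T_i\subseteq 2^{<\omega}$ (where $[T]$ is the set of infinite paths), and $\Delta^0_2$ if both $\mathcal A$ and $2^\omega\setminus\mathcal A$ are $\Sigma^0_2$. $\chi_{\mathcal A}$ is the characteristic function of $\mathcal A$, with values in $\{0,1\}\subseteq\omega$. A representation of a set $X$ is a surjective partial map $\delta_X:\subseteq\omega^\omega\to X$. A realizer of a multi-valued partial function $f:\subseteq X\rightrightarrows Y$ is a partial $\Gamma:\subseteq\omega^\omega\to\omega^\omega$ with $\delta_Y(\Gamma(p))\in f(\delta_X(p))$ for all $p\in\mathrm{dom}(f\circ\delta_X)$. $f\le_{\mathrm W} g$ if there are Turing functionals $\Phi,\Psi$ such that $p\mapsto\Psi(\langle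 p,\Gamma(\Phi(p))\rangle)$ realizes $f$ for every realizer $\Gamma$ of $g$. $\mathrm{MLR}$ is represented by the identity on $\mathrm{MLR}\subseteq\omega^\omega$, $\omega$ by $\chi_{\{n\}}\mapsto n$. $\mathsf{LAY}_{\mathcal U}\colon\mathrm{MLR}\rightrightarrows\omega$, $\mathsf{LAY}_{\mathcal U}(X)=\{i:X\notin\mathcal U_i\}$. *)

(* Defs.v *)
From Stdlib Require Import List Arith Reals.
Import ListNotations.
Open Scope R_scope.

Inductive prog : Type :=
| PZero : prog
| PSucc : prog
| PProj : nat -> prog
| POracle : prog
| PComp : prog -> list prog -> prog
| PPrec : prog -> prog -> prog
| PMu : prog -> prog.

Inductive eval (o : nat -> nat) : prog -> list nat -> nat -> Prop :=
| ev_zero : forall args, eval o PZero args 0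
| ev_succ : forall args, eval o PSucc args (S (hd 0%nat args))
| ev_proj : forall i args, eval o (PProj i) args (nth i args 0%nat)
| ev_oracle : forall args, eval o POracle args (o (hd 0%nat args))
| ev_comp : forall f gs args ys v,
    evals o gs args ys -> eval o f ys v -> eval o (PComp f gs) args v
| ev_prec0 : forall f g rest v,
    eval o f rest v -> eval o (PPrec f g) (0%nat :: rest) v
| ev_precS : forall f g m rest r v,
    eval o (PPrec f g) (m :: rest) r -> eval o g (m :: r :: rest) v ->
    eval o (PPrec f g) (S m :: rest) v
| ev_mu : forall f args v,
    eval o f (v :: args) 0%nat ->
    (forall w, (w < v)%nat -> exists u, eval o f (w :: args) (S u)) ->
    eval o (PMu f) args v
with evals (o : nat -> nat) : list prog -> list nat -> list nat -> Prop :=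
| evs_nil : forall args, evals o [] args []
| evs_cons : forall g gs args y ys,
    eval o g args y -> evals o gs args ys -> evals o (g :: gs) args (y :: ys).

Definition o0 : nat -> nat := fun _ => 0%nat.

Definition Baire := nat -> nat.

Definition TF (e : prog) (p q : Baire) : Prop :=
  forall n, eval p e [n] (q n).

Definition pairB (p q : Baire) : Baire :=
  fun n => if Nat.even n then p (Nat.div2 n) else q (Nat.div2 n).

Definition cantor := nat -> bool.

Fixpoint prefix (X : cantor) (n : nat) : list bool :=
  match n with
  | O => []
  | S m => prefix X m ++ [X m]
  end.

Definition is_prefix (s t : list bool) : Prop := exists r, t = s ++ r.

Definition cyl (s : list bool) (X : cantor) : Prop := prefix X (length s) = s.

Definition cyl_sub (s : list bool) (V : cantor -> Prop) : Prop :=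
  forall Y, cyl s Y -> V Y.

Definition open_set (V : cantor -> Prop) : Prop :=
  forall X, V X -> exists n, cyl_sub (prefix X n) V.

Fixpoint code (s : list bool) : nat :=
  match s with
  | [] => 1%nat
  | b :: s' => (2 * code s' + (if b then 1 else 0))%nat
  end.

Definition ce2 (S : nat -> list bool -> Prop) : Prop :=
  exists e : prog, forall i s, S i s <-> exists v, eval o0 e [i; code s] v.

(** * Lebesgue measure of open sets:
    lambda(V) <= q iff every finite union of pairwise disjoint cylinders
    inside V has measure <= q. *)
Definition prefix_free (l : list (list bool)) : Prop :=
  forall j k, (j < length l)%nat -> (k < length l)%nat -> j <> k ->
    ~ is_prefix (nth j l []) (nth k l []).

Fixpoint strings_measure (l : list (list bool)) : R :=
  match l with
  | [] => 0
  | s :: l' => (/ 2) ^ length s + strings_measure l'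
  end.

Definition measure_le (V : cantor -> Prop) (q : R) : Prop :=
  forall l, prefix_free l -> (forall s, In s l -> cyl_sub s V) ->
    strings_measure l <= q.

Definition ML_test (V : nat -> cantor -> Prop) : Prop :=
  (forall i, open_set (V i)) /\
  ce2 (fun i s => cyl_sub s (V i)) /\
  (forall i, measure_le (V i) ((/ 2) ^ i)).

Definition universal_ML_test (U : nat -> cantor -> Prop) : Prop :=
  ML_test U /\
  forall V, ML_test V -> forall X, (forall i, V i X) -> forall i, U i X.

Definition MLR (X : cantor) : Prop :=
  forall V, ML_test V -> exists i, ~ V i X.

Definition paths (T : list bool -> bool) (X : cantor) : Prop :=
  forall n, T (prefix X n) = true.

Definition Sigma02 (A : cantor -> Prop) : Prop :=
  exists T : nat -> list bool -> bool,
    (exists e : prog, forall i s,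
        eval o0 e [i; code s] (if T i s then 1%nat else 0%nat)) /\
    (forall i s t, T i t = true -> is_prefix s t -> T i s = true) /\
    (forall X, A X <-> exists i, paths (T i) X).

Definition Delta02 (A : cantor -> Prop) : Prop :=
  Sigma02 A /\ Sigma02 (fun X => ~ A X).

(** representation as a (functional) relation: [delta p x] iff delta(p) = x *)
Definition representation (X : Type) := Baire -> X -> Prop.

(** multi-valued partial function f :\subseteq X ==> Y as a relation *)
Definition mvf (X Y : Type) := X -> Y -> Prop.

Definition realizer {X Y : Type} (dX : representation X) (dY : representation Y)
  (f : mvf X Y) (G : Baire -> option Baire) : Prop :=
  forall p x, dX p x -> (exists y, f x y) ->
    exists q y, G p = Some q /\ dY q y /\ f x y.

Definition weihrauch_le {X Y Z W : Type}
  (dX : representation X) (dY : representation Y)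
  (dZ : representation Z) (dW : representation W)
  (f : mvf X Y) (g : mvf Z W) : Prop :=
  exists ePhi ePsi : prog,
    forall G, realizer dZ dW g G ->
      forall p x, dX p x -> (exists y, f x y) ->
        exists q1 r s y,
          TF ePhi p q1 /\ G q1 = Some r /\ TF ePsi (pairB p r) s /\
          dY s y /\ f x y.

Definition delta_MLR : representation cantor :=
  fun p X => (forall n, (p n <= 1)%nat) /\
             (forall n, p n = (if X n then 1%nat else 0%nat)) /\ MLR X.

Definition chi_singleton (n : nat) : Baire :=
  fun k => if Nat.eqb k n then 1%nat else 0%nat.

Definition delta_nat : representation nat := fun p n => p = chi_singleton n.

Definition chi_MLR (A : cantor -> Prop) : mvf cantor nat :=
  fun X n => MLR X /\ ((A X /\ n = 1%nat) \/ (~ A X /\ n = 0%nat)).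

Definition LAY (U : nat -> cantor -> Prop) : mvf cantor nat :=
  fun X i => MLR X /\ ~ U i X.

(* Main.v *)
(** Let 2^ω be the union of the closed sets R_0, R_1, ..., where the R_{2a} exhaust A and the R_{2a+1} exhaust its complement.  Reading a sequence X, guess the least index of a closed set that X has not yet been seen to leave; the guess changes finitely often, and the parity of its limit decides membership in A.

    The reduction does not query X itself but a damaged copy Y: after a change of the guess at stage s, the bits of X are replaced by zeros until the initial segment of Y is seen to generate a cylinder inside U_k for every k <= s.  This wait is finite, since otherwise Y would end in zeros, hence lie in every U_k by universality.  So Y differs from X at finitely many places and is random, while Y lies in U_k whenever the guess changes at a stage s >= k.  Given any i with Y not in U_i, the guess at stage i is therefore final. *)

(* A layer number for a sequence says nothing about how often the guess changes on it. The link is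
   created by steering the queried sequence into layers after each change, and zeros serve for this
   because a sequence ending in zeros is computable, hence not random. All [k <= s] are awaited,
   since a test need not be decreasing. The programs given for the trees and for the test run with
   the oracle [o0], whereas the two reductions run with the oracles [p] and [pairB p r]. Therefore
   oracle-free programs are replaced by fuel-bounded simulations that give the same values with
   every oracle. The same simulations turn the enumeration of the test into a check that can be made
   at each stage. *)
Require Import Defs.
From Stdlib Require Import List Arith Reals.
From Stdlib Require Import Lia Lra Classical FunctionalExtensionality.
Import ListNotations.
Local Open Scope nat_scope.

(** * Relative computability of total functions *)

(* [PPrec] and [PMu] push arguments onto the list, so a program is only specified on argument lists of the declared length. *)
Definition computable (k : nat) (F : Baire -> list nat -> nat) : Prop :=
  exists e, forall o l, length l = k -> eval o e l (F o l).

Lemma computable_ext k F G :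
  (forall o l, length l = k -> F o l = G o l) -> computable k F -> computable k G.
Proof.
  intros H [e He]. exists e. intros o l Hl. rewrite <- H by exact Hl. now apply He.
Qed.

Lemma computable_proj k i : computable k (fun _ l => nth i l 0).
Proof. exists (PProj i). intros. constructor. Qed.

Lemma computable_skipn_proj k d i : computable k (fun _ l => nth i (skipn d l) 0).
Proof.
  apply computable_ext with (F := fun _ l => nth (d + i) l 0); [|apply computable_proj].
  intros o l _. symmetry. apply nth_skipn.
Qed.

Lemma computable_evals k Gs :
  Forall (computable k) Gs ->
  exists es, forall o l, length l = k -> evals o es l (map (fun G => G o l) Gs).
Proof.
  induction 1 as [|G Gs [e He] _ [es Hes]].
  - exists []. intros. constructor.
  - exists (e :: es). intros. simpl. constructor; auto.
Qed.

Lemma computable_comp k Gs F :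
  Forall (computable k) Gs -> computable (length Gs) F ->
  computable k (fun o l => F o (map (fun G => G o l) Gs)).
Proof.
  intros HG [e He]. destruct (computable_evals k Gs HG) as [es Hes].
  exists (PComp e es). intros o l Hl. econstructor; [now apply Hes|].
  apply He. now rewrite length_map.
Qed.

Lemma skipn_map_nth d k (l : list nat) :
  length l = d + k -> skipn d l = map (fun i => nth (d + i) l 0) (seq 0 k).
Proof.
  intros Hl. apply nth_ext with (d := 0) (d' := 0).
  - rewrite length_skipn, length_map, length_seq. lia.
  - intros i Hi. rewrite length_skipn in Hi. rewrite nth_skipn.
    rewrite (nth_indep (map _ _) 0 (nth (d + 0) l 0)) by (rewrite length_map, length_seq; lia).
    rewrite (map_nth (fun i => nth (d + i) l 0)), seq_nth by lia. reflexivity.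
Qed.

(** The shape of a call from inside a recursion or a search: [d] leading arguments are exchanged for
    [a] new ones, while the [k] parameters behind them stay. *)
Lemma computable_comp_skip a d k j Gs F :
  Forall (computable j) Gs -> length Gs = a -> j = d + k ->
  computable (a + k) F ->
  computable j (fun o l => F o (map (fun G => G o l) Gs ++ skipn d l)).
Proof.
  intros HG Ha Hj HF.
  set (Ps := map (fun i (_ : Baire) (l : list nat) => nth (d + i) l 0) (seq 0 k)).
  apply computable_ext with
    (F := fun o l => F o (map (fun G => G o l) (Gs ++ Ps))).
  - intros o l Hl. f_equal. rewrite map_app. f_equal. unfold Ps.
    rewrite map_map. symmetry. apply skipn_map_nth. lia.
  - apply computable_comp.
    + apply Forall_app. split; [exact HG|]. apply Forall_forall.
      intros G HGin. apply in_map_iff in HGin as [i [<- _]]. apply computable_proj.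
    + unfold Ps. rewrite length_app, length_map, length_seq, Ha. exact HF.
Qed.

(** With this and its binary and ternary versions, a closure property has to be checked only on
    projections from a list of fixed length. *)
Lemma computable_app1 k (f : Baire -> nat -> nat) F :
  computable 1 (fun o l => f o (nth 0 l 0)) ->
  computable k F -> computable k (fun o l => f o (F o l)).
Proof.
  intros Hf HF. apply (computable_comp k [F] _ (Forall_cons _ HF (Forall_nil _)) Hf).
Qed.

Lemma computable_app2 k (f : Baire -> nat -> nat -> nat) F G :
  computable 2 (fun o l => f o (nth 0 l 0) (nth 1 l 0)) ->
  computable k F -> computable k G -> computable k (fun o l => f o (F o l) (G o l)).
Proof.
  intros Hf HF HG. apply (computable_comp k [F; G] (fun o l => f o (nth 0 l 0) (nth 1 l 0))); auto.
Qed.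

Lemma computable_app3 k (f : Baire -> nat -> nat -> nat -> nat) F G H :
  computable 3 (fun o l => f o (nth 0 l 0) (nth 1 l 0) (nth 2 l 0)) ->
  computable k F -> computable k G -> computable k H ->
  computable k (fun o l => f o (F o l) (G o l) (H o l)).
Proof.
  intros Hf HF HG HH. apply (computable_comp k [F; G; H]
    (fun o l => f o (nth 0 l 0) (nth 1 l 0) (nth 2 l 0))); auto.
Qed.

Lemma computable_oracle k F : computable k F -> computable k (fun o l => o (F o l)).
Proof.
  apply (computable_app1 k (fun o x => o x)). exists POracle. intros o l _.
  replace (nth 0 l 0) with (hd 0 l) by now destruct l. constructor.
Qed.

Lemma computable_S k F : computable k F -> computable k (fun o l => S (F o l)).
Proof.
  apply (computable_app1 k (fun _ x => S x)). exists PSucc. intros o l _.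
  replace (nth 0 l 0) with (hd 0 l) by now destruct l. constructor.
Qed.

Lemma computable_const k n : computable k (fun _ _ => n).
Proof.
  induction n as [|n IH]; [|now apply computable_S].
  exists PZero. intros. constructor.
Qed.

Lemma evals_args k : exists es, forall o l, length l = k -> evals o es l l.
Proof.
  set (Ps := map (fun i (_ : Baire) (l : list nat) => nth i l 0) (seq 0 k)).
  destruct (computable_evals k Ps) as [es Hes].
  { apply Forall_forall. intros G HGin. apply in_map_iff in HGin as [i [<- _]].
    apply computable_proj. }
  exists es. intros o l Hl. specialize (Hes o l Hl). unfold Ps in Hes. rewrite map_map in Hes.
  rewrite (skipn_map_nth 0 k l Hl : l = _) at 2. exact Hes.
Qed.

Definition natrec (b : nat) (g : nat -> nat -> nat) (n : nat) : nat :=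
  nat_rect (fun _ => nat) b g n.

(** The step program sees the counter and the previous value in front of the parameters, which are
    thus [skipn 2 l]. *)
Lemma computable_natrec k N B (g : Baire -> list nat -> nat -> nat -> nat) :
  computable k N -> computable k B ->
  computable (S (S k)) (fun o l => g o (skipn 2 l) (nth 0 l 0) (nth 1 l 0)) ->
  computable k (fun o l => natrec (B o l) (g o l) (N o l)).
Proof.
  intros [eN HN] [eB HB] [eG HG].
  destruct (evals_args k) as [es Hes].
  exists (PComp (PPrec eB eG) (eN :: es)). intros o l Hl.
  econstructor.
  - constructor; [now apply HN|now apply Hes].
  - induction (N o l) as [|n IH]; simpl.
    + constructor. now apply HB.
    + econstructor; [exact IH|].
      apply (HG o (n :: natrec (B o l) (g o l) n :: l)). simpl. now rewrite Hl.
Qed.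

Definition ifz (n a b : nat) : nat := match n with O => a | S _ => b end.

Lemma computable_ifz k N A B :
  computable k N -> computable k A -> computable k B ->
  computable k (fun o l => ifz (N o l) (A o l) (B o l)).
Proof.
  apply (computable_app3 k (fun _ n a b => ifz n a b)).
  apply computable_ext with (F := fun o l => natrec (nth 1 l 0)
    (fun _ _ => nth 2 l 0) (nth 0 l 0)).
  - intros o l _. now destruct (nth 0 l 0).
  - apply (computable_natrec 3 _ _ (fun _ l _ _ => nth 2 l 0));
      [apply computable_proj | apply computable_proj | apply computable_skipn_proj].
Qed.

Lemma computable_add k F G :
  computable k F -> computable k G -> computable k (fun o l => F o l + G o l).
Proof.
  apply (computable_app2 k (fun _ a b => a + b)).
  apply computable_ext with (F := fun o l => natrec (nth 1 l 0) (fun _ r => S r) (nth 0 l 0)).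
  - intros o l _. induction (nth 0 l 0) as [|n IH]; simpl; [reflexivity|]. now f_equal.
  - apply (computable_natrec 2 _ _ (fun _ _ _ r => S r));
      [apply computable_proj | apply computable_proj |].
    apply computable_S, computable_proj.
Qed.

Lemma computable_mul k F G :
  computable k F -> computable k G -> computable k (fun o l => F o l * G o l).
Proof.
  apply (computable_app2 k (fun _ a b => a * b)).
  apply computable_ext with
    (F := fun o l => natrec 0 (fun _ r => nth 1 l 0 + r) (nth 0 l 0)).
  - intros o l _. induction (nth 0 l 0) as [|n IH]; simpl; [reflexivity|]. now f_equal.
  - apply (computable_natrec 2 _ _ (fun _ l _ r => nth 1 l 0 + r));
      [apply computable_proj | apply computable_const |].
    apply computable_add; [apply computable_skipn_proj|apply computable_proj].
Qed.

Lemma computable_pred k F : computable k F -> computable k (fun o l => pred (F o l)).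
Proof.
  apply (computable_app1 k (fun _ a => pred a)).
  apply computable_ext with (F := fun o l => natrec 0 (fun m _ => m) (nth 0 l 0)).
  - intros o l _. now destruct (nth 0 l 0).
  - apply (computable_natrec 1 _ _ (fun _ _ m _ => m));
      [apply computable_proj | apply computable_const | apply computable_proj].
Qed.

Lemma computable_sub k F G :
  computable k F -> computable k G -> computable k (fun o l => F o l - G o l).
Proof.
  apply (computable_app2 k (fun _ a b => a - b)).
  apply computable_ext with (F := fun o l => natrec (nth 0 l 0) (fun _ r => pred r) (nth 1 l 0)).
  - intros o l _. induction (nth 1 l 0) as [|n IH]; [symmetry; apply Nat.sub_0_r|].
    change (pred (natrec (nth 0 l 0) (fun _ r => pred r) n) = nth 0 l 0 - S n).
    rewrite IH. lia.
  - apply (computable_natrec 2 _ _ (fun _ _ _ r => pred r));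
      [apply computable_proj | apply computable_proj |].
    apply computable_pred, computable_proj.
Qed.

Ltac computable_basic := repeat first
  [ simple apply computable_proj | simple apply computable_skipn_proj
  | simple apply computable_const | simple apply computable_S
  | simple apply computable_add | simple apply computable_mul | simple apply computable_sub
  | simple apply computable_pred | simple apply computable_ifz | assumption ].

(** * Binary digits and bounded search *)

Definition parity (n : nat) : nat := natrec 0 (fun _ r => 1 - r) n.

Lemma parity_S n : parity (S n) = 1 - parity n.
Proof. reflexivity. Qed.

(** Phrased with [2 * a + b] because this is how [code] builds the number of a nonempty string. *)
Lemma parity_spec n a b : n = 2 * a + b -> b <= 1 -> parity n = b.
Proof.
  intros -> Hb. induction a as [|a IH].
  - destruct b as [|[|b]]; simpl; [reflexivity|reflexivity|lia].
  - replace (2 * S a + b) with (S (S (2 * a + b))) by lia.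
    rewrite !parity_S, IH. lia.
Qed.

Lemma computable_parity k F : computable k F -> computable k (fun o l => parity (F o l)).
Proof.
  apply (computable_app1 k (fun _ a => parity a)).
  apply (computable_natrec 1 _ _ (fun _ _ _ r => 1 - r)); computable_basic.
Qed.

(** The half grows from [m] to [S m] exactly when [m] is odd. *)
Definition half (n : nat) : nat := natrec 0 (fun m r => r + parity m) n.

Lemma half_S n : half (S n) = half n + parity n.
Proof. reflexivity. Qed.

Lemma half_spec n a b : n = 2 * a + b -> b <= 1 -> half n = a.
Proof.
  intros -> Hb. induction a as [|a IH].
  - destruct b as [|[|b]]; simpl; [reflexivity|reflexivity|lia].
  - replace (2 * S a + b) with (S (S (2 * a + b))) by lia.
    rewrite !half_S, IH, parity_S, (parity_spec _ a b eq_refl Hb). lia.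
Qed.

Lemma computable_half k F : computable k F -> computable k (fun o l => half (F o l)).
Proof.
  apply (computable_app1 k (fun _ a => half a)).
  apply (computable_natrec 1 _ _ (fun _ _ m r => r + parity m)).
  - computable_basic.
  - computable_basic.
  - apply computable_add; [|apply computable_parity]; computable_basic.
Qed.

Definition pow2 (n : nat) : nat := natrec 1 (fun _ r => r + r) n.

Lemma computable_pow2 k F : computable k F -> computable k (fun o l => pow2 (F o l)).
Proof.
  apply (computable_app1 k (fun _ a => pow2 a)).
  apply (computable_natrec 1 _ _ (fun _ _ _ r => r + r)); computable_basic.
Qed.

(** The first bit of a string is the least significant bit of its code, so this drops the first [j]
    bits. *)
Definition shift (c j : nat) : nat := natrec c (fun _ r => half r) j.

Lemma computable_shift k F G :
  computable k F -> computable k G -> computable k (fun o l => shift (F o l) (G o l)).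
Proof.
  apply (computable_app2 k (fun _ a b => shift a b)).
  apply (computable_natrec 2 _ _ (fun _ _ _ r => half r)).
  - computable_basic.
  - computable_basic.
  - apply computable_half; computable_basic.
Qed.

Definition bex (P : nat -> nat) (n : nat) : nat := natrec 0 (fun m r => ifz (P m) r 1) n.

Lemma bex_spec P n : bex P n <> 0 <-> exists m, m < n /\ P m <> 0.
Proof.
  induction n as [|n IH].
  - cbn. split; [easy|]. intros [m [Hm _]]. lia.
  - change (bex P (S n)) with (ifz (P n) (bex P n) 1). split.
    + destruct (P n) eqn:E; simpl.
      * intros H. apply IH in H as [m [Hm H]]. exists m. split; [lia|exact H].
      * intros _. exists n. split; [lia|]. now rewrite E.
    + intros [m [Hm H]]. destruct (P n) eqn:E; simpl; [|easy].
      apply IH. exists m. split; [|exact H].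
      assert (m <> n) by (intros ->; contradiction). lia.
Qed.

Lemma computable_bex k N (P : Baire -> list nat -> nat -> nat) :
  computable k N ->
  computable (S (S k)) (fun o l => P o (skipn 2 l) (nth 0 l 0)) ->
  computable k (fun o l => bex (P o l) (N o l)).
Proof.
  intros HN HP.
  apply (computable_natrec k N (fun _ _ => 0) (fun o l m r => ifz (P o l m) r 1)); computable_basic.
Qed.

(** * Simulation of oracle-free programs with bounded running time *)

(** The generated principle gives no hypothesis for the programs in the list of a [PComp]. *)
Lemma prog_list_ind (P : prog -> Prop) :
  P PZero -> P PSucc -> (forall i, P (PProj i)) -> P POracle ->
  (forall f gs, P f -> Forall P gs -> P (PComp f gs)) ->
  (forall f g, P f -> P g -> P (PPrec f g)) ->
  (forall f, P f -> P (PMu f)) ->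
  forall e, P e.
Proof.
  intros HZ HS HP HO HC HR HM. fix IH 1. intros [| |i| |f gs|f g|f].
  - exact HZ.
  - exact HS.
  - apply HP.
  - exact HO.
  - apply HC; [apply IH|]. induction gs as [|g gs IHgs]; constructor; [apply IH|exact IHgs].
  - apply HR; apply IH.
  - apply HM; apply IH.
Qed.

(* [F t l] is [S v] if [e] was found to return [v] on [l] with fuel [t], and [0] otherwise. The simulating function is computable relative to every oracle although [e] is run with [o0]. *)
Definition simulates (k : nat) (e : prog) (F : nat -> list nat -> nat) : Prop :=
  computable (S k) (fun _ l => F (nth 0 l 0) (tl l)) /\
  (forall t l v, length l = k -> F t l = S v -> eval o0 e l v) /\
  (forall l v, length l = k -> eval o0 e l v ->
     exists t0, forall t, t0 <= t -> F t l = S v).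

Lemma computable_tl_proj k i : computable (S k) (fun _ l => nth i (tl l) 0).
Proof.
  apply computable_ext with (F := fun _ l => nth (S i) l 0); [|apply computable_proj].
  intros o [|a l] Hl; [discriminate Hl|reflexivity].
Qed.

Lemma computable_sim_comp k j F A Gs :
  computable (S k) (fun _ l => F (nth 0 l 0) (tl l)) ->
  computable j A -> Forall (computable j) Gs -> length Gs = k ->
  computable j (fun o l => F (A o l) (map (fun G => G o l) Gs)).
Proof.
  intros HF HA HG Hk.
  apply (computable_comp j (A :: Gs) (fun _ l => F (nth 0 l 0) (tl l))).
  - now constructor.
  - simpl. now rewrite Hk.
Qed.

Lemma computable_sim_skip a d k j F A Gs :
  computable (S (a + k)) (fun _ l => F (nth 0 l 0) (tl l)) ->
  computable j A -> Forall (computable j) Gs -> length Gs = a -> j = d + k ->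
  computable j (fun o l => F (A o l) (map (fun G => G o l) Gs ++ skipn d l)).
Proof.
  intros HF HA HG Ha Hj.
  apply (computable_comp_skip (S a) d k j (A :: Gs) (fun _ l => F (nth 0 l 0) (tl l))).
  - now constructor.
  - simpl. now rewrite Ha.
  - exact Hj.
  - exact HF.
Qed.

Definition outputs (Fs : list (nat -> list nat -> nat)) (t : nat) (l : list nat) : list nat :=
  map (fun F => F t l) Fs.

Lemma evals_sound k gs Fs t l :
  Forall2 (simulates k) gs Fs -> length l = k -> ~ In 0 (outputs Fs t l) ->
  evals o0 gs l (map pred (outputs Fs t l)).
Proof.
  intros H Hl. induction H as [|g F gs Fs [_ [Hs _]] _ IH]; simpl; intros Hn; constructor.
  - apply (Hs t); [exact Hl|]. destruct (F t l); [exfalso; apply Hn; now left|reflexivity].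
  - apply IH. intros Hin. apply Hn. now right.
Qed.

Lemma evals_complete k gs Fs l ys :
  Forall2 (simulates k) gs Fs -> length l = k -> evals o0 gs l ys ->
  exists t0, forall t, t0 <= t -> outputs Fs t l = map S ys.
Proof.
  intros H Hl. revert ys. induction H as [|g F gs Fs [_ [_ Hc]] _ IH]; intros ys He.
  - exists 0. inversion He; subst. reflexivity.
  - inversion He as [|? ? ? y ys' Hy Hys]; subst.
    destruct (Hc l y eq_refl Hy) as [t1 H1]. destruct (IH ys' Hys) as [t2 H2].
    exists (t1 + t2). intros t Ht. simpl.
    rewrite (H1 t) by lia. f_equal. apply H2. lia.
Qed.

Definition all_pos (l : list nat) : nat := fold_right (fun x r => ifz x 0 r) 1 l.

Lemma all_pos_spec l : all_pos l <> 0 <-> ~ In 0 l.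
Proof.
  induction l as [|[|x] l IH]; simpl.
  - split; [easy|]. intros _. discriminate.
  - split; [easy|]. intros H. exfalso. apply H. now left.
  - rewrite IH. split; intros H; [intros [|]; [discriminate|auto]|auto].
Qed.

(** All subprograms get the same fuel, and the answer is [0] while one argument is missing. Since
    results persist from a threshold on, the sum of the thresholds suffices. *)
Lemma simulates_comp k f gs Ff Fs :
  simulates (length gs) f Ff -> Forall2 (simulates k) gs Fs ->
  simulates k (PComp f gs)
    (fun t l => ifz (all_pos (outputs Fs t l)) 0 (Ff t (map pred (outputs Fs t l)))).
Proof.
  intros [Hrf [Hsf Hcf]] HFs.
  assert (Hlen : length gs = length Fs) by exact (Forall2_length HFs).
  split; [|split].
  - assert (HFs' : Forall (fun F => computable (S k) (fun _ l => F (nth 0 l 0) (tl l))) Fs).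
    { clear -HFs. induction HFs as [|g F gs Fs [H _] _ IH]; constructor; auto. }
    apply computable_ifz; [|apply computable_const|].
    + clear -HFs'. induction HFs' as [|F Fs HF _ IH]; simpl; computable_basic.
    + apply computable_ext with (F := fun o l => Ff (nth 0 l 0)
        (map (fun G => G o l) (map (fun F (_ : Baire) l => pred (F (nth 0 l 0) (tl l))) Fs))).
      { intros o l _. f_equal. unfold outputs. now rewrite !map_map. }
      apply (computable_sim_comp (length gs)); [exact Hrf|computable_basic| |].
      * clear -HFs'. induction HFs' as [|F Fs HF _ IH]; simpl; constructor; computable_basic.
      * now rewrite length_map.
  - intros t l v Hl H. destruct (all_pos (outputs Fs t l)) eqn:E; [discriminate H|].
    apply ev_comp with (ys := map pred (outputs Fs t l)).
    + apply (evals_sound k); [exact HFs|exact Hl|]. apply all_pos_spec. now rewrite E.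
    + apply (Hsf t); [|exact H]. unfold outputs. now rewrite !length_map.
  - intros l v Hl He. inversion He as [| | | |? ? ? ys ? Hys Hf| | |]; subst.
    destruct (evals_complete _ _ _ _ ys HFs eq_refl Hys) as [t1 H1].
    assert (Hl : length ys = length gs).
    { specialize (H1 t1 (le_n _)). apply (f_equal (@length nat)) in H1.
      unfold outputs in H1. rewrite !length_map in H1. lia. }
    destruct (Hcf ys v Hl Hf) as [t2 H2]. exists (t1 + t2). intros t Ht.
    rewrite H1 by lia. destruct (all_pos (map S ys)) eqn:E.
    + exfalso. apply (proj2 (all_pos_spec (map S ys))); [|exact E].
      intros Hin. apply in_map_iff in Hin as [y [Hy _]]. discriminate Hy.
    + simpl. rewrite map_map, map_id. apply H2. lia.
Qed.

(** The recursion runs on the shifted values, so that a missing value [0] is passed on up to the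
    end. *)
Lemma simulates_prec k f g Ff Fg :
  simulates k f Ff -> simulates (S (S k)) g Fg ->
  simulates (S k) (PPrec f g)
    (fun t l => natrec (Ff t (skipn 1 l))
       (fun m r => ifz r 0 (Fg t (m :: pred r :: skipn 1 l))) (nth 0 l 0)).
Proof.
  intros [Hrf [Hsf Hcf]] [Hrg [Hsg Hcg]]. split; [|split].
  - apply (computable_natrec (S (S k)) _ (fun _ l => Ff (nth 0 l 0) (skipn 1 (tl l)))
      (fun _ l m r => ifz r 0 (Fg (nth 0 l 0) (m :: pred r :: skipn 1 (tl l))))).
    + apply computable_tl_proj.
    + apply computable_ext with (F := fun o l => Ff (nth 0 l 0)
        (map (fun G : Baire -> list nat -> nat => G o l) [] ++ skipn 2 l)).
      { intros o l _. now destruct l as [|? [|? [|? [|? l]]]]. }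
      apply (computable_sim_skip 0 2 k); computable_basic; auto.
    + apply computable_ifz; [computable_basic|computable_basic|].
      apply computable_ext with (F := fun o l => Fg (nth 2 l 0)
        (map (fun G : Baire -> list nat -> nat => G o l)
           [(fun _ l => nth 0 l 0); (fun _ l => pred (nth 1 l 0))] ++ skipn 4 l)).
      { intros o l _. now destruct l as [|? [|? [|? [|? l]]]]. }
      apply (computable_sim_skip 2 4 k); computable_basic; auto.
      repeat constructor; computable_basic.
  - intros t [|m l] v Hl; [discriminate Hl|]. injection Hl as Hl. simpl. revert v.
    induction m as [|m IH]; intros v H.
    + constructor. now apply (Hsf t).
    + unfold natrec in H. simpl in H. fold (natrec (Ff t l)
        (fun m r => ifz r 0 (Fg t (m :: pred r :: l))) m) in H.
      destruct (natrec (Ff t l) (fun m r => ifz r 0 (Fg t (m :: pred r :: l))) m)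
        as [|r]; [discriminate H|].
      apply ev_precS with (r := r); [now apply IH|].
      apply (Hsg t); [simpl; lia|exact H].
  - intros [|m l] v Hl; [discriminate Hl|]. injection Hl as Hl. simpl. revert v.
    induction m as [|m IH]; intros v H.
    + inversion H; subst. now apply Hcf.
    + inversion H as [| | | | | |? ? ? ? r ? H1 H2|]; subst.
      destruct (IH r H1) as [t1 Ht1].
      destruct (Hcg (m :: r :: l) v eq_refl H2) as [t2 Ht2].
      exists (t1 + t2). intros t Ht. unfold natrec in *. simpl.
      rewrite (Ht1 t) by lia. simpl. apply Ht2. lia.
Qed.

(* State of the search for the least [w < t] with [x w = 1]: [0] while no decision has been taken, [1] after hitting a [w] with [x w = 0], and [S (S w)] once [w] is found. *)
Definition search (x : nat -> nat) (t : nat) : nat :=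
  natrec 0 (fun w r => ifz r (ifz (x w) 1 (ifz (pred (x w)) (S (S w)) 0)) r) t.

Lemma search_S x t :
  search x (S t) = ifz (search x t) (ifz (x t) 1 (ifz (pred (x t)) (S (S t)) 0)) (search x t).
Proof. reflexivity. Qed.

Lemma search_undecided x t : search x t = 0 -> forall w, w < t -> 2 <= x w.
Proof.
  induction t as [|t IH]; intros H w Hw; [lia|]. rewrite search_S in H.
  destruct (search x t) as [|r]; simpl in H; [|discriminate H].
  destruct (x t) as [|[|y]] eqn:E; simpl in H; try discriminate H.
  destruct (Nat.eq_dec w t) as [->|Hne]; [lia|]. apply IH; [reflexivity|lia].
Qed.

Lemma search_sound x t v :
  search x t = S (S v) -> x v = 1 /\ forall w, w < v -> 2 <= x w.
Proof.
  induction t as [|t IH]; intros H; [discriminate H|]. rewrite search_S in H.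
  destruct (search x t) as [|r] eqn:Es; simpl in H; [|now apply IH].
  destruct (x t) as [|[|y]] eqn:E; simpl in H; try discriminate H.
  injection H as <-. split; [exact E|]. now apply search_undecided.
Qed.

Lemma search_complete x t v :
  x v = 1 -> (forall w, w < v -> 2 <= x w) -> v < t -> search x t = S (S v).
Proof.
  intros Hv Hw.
  assert (H0 : forall s, s <= v -> search x s = 0).
  { induction s as [|s IH]; intros Hs; [reflexivity|]. rewrite search_S, IH by lia.
    specialize (Hw s ltac:(lia)). destruct (x s) as [|[|y]]; [lia|lia|reflexivity]. }
  induction t as [|t IH]; intros Ht; [lia|]. rewrite search_S.
  destruct (Nat.eq_dec v t) as [->|Hne].
  - rewrite H0, Hv by lia. reflexivity.
  - rewrite IH by lia. reflexivity.
Qed.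

(** The fuel bounds both the candidates and the run on each of them. An unfinished run blocks the
    search, as a smaller zero might still be found there. *)
Lemma simulates_mu k f Ff :
  simulates (S k) f Ff ->
  simulates k (PMu f) (fun t l => pred (search (fun w => Ff t (w :: l)) t)).
Proof.
  intros [Hrf [Hsf Hcf]]. split; [|split].
  - apply computable_pred.
    assert (HF : computable (S (S (S k)))
      (fun _ l => Ff (nth 0 (skipn 2 l) 0) (nth 0 l 0 :: tl (skipn 2 l)))).
    { apply computable_ext with (F := fun o l => Ff (nth 2 l 0)
        (map (fun G : Baire -> list nat -> nat => G o l) [fun _ l => nth 0 l 0] ++ skipn 3 l)).
      { intros o l _. now destruct l as [|? [|? [|? [|? l]]]]. }
      apply (computable_sim_skip 1 3 k); computable_basic; auto.
      repeat constructor; computable_basic. }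
    apply (computable_natrec (S k) _ (fun _ _ => 0) (fun _ l w r =>
      ifz r (ifz (Ff (nth 0 l 0) (w :: tl l)) 1
               (ifz (pred (Ff (nth 0 l 0) (w :: tl l))) (S (S w)) 0)) r));
    computable_basic.
  - intros t l v Hl H.
    assert (Hs : search (fun w => Ff t (w :: l)) t = S (S v)).
    { destruct (search (fun w => Ff t (w :: l)) t); simpl in H; [discriminate H|congruence]. }
    apply search_sound in Hs as [Hv Hw]. constructor.
    + apply (Hsf t); [simpl; lia|exact Hv].
    + intros w Hlt. specialize (Hw w Hlt). exists (Ff t (w :: l) - 2).
      apply (Hsf t); [simpl; lia|lia].
  - intros l v Hl He. inversion He as [| | | | | | |? ? ? Hv Hw]; subst.
    destruct (Hcf (v :: l) 0 eq_refl Hv) as [t1 Ht1].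
    (* A common fuel for the finitely many candidates below [v]. *)
    assert (Hall : forall n, n <= v ->
      exists t0, forall t, t0 <= t -> forall w, w < n -> 2 <= Ff t (w :: l)).
    { induction n as [|n IH]; intros Hn; [exists 0; intros; lia|].
      destruct IH as [t2 Ht2]; [lia|]. destruct (Hw n) as [u Hu]; [lia|].
      destruct (Hcf (n :: l) (S u) eq_refl Hu) as [t3 Ht3].
      exists (t2 + t3). intros t Ht w Hlt. destruct (Nat.eq_dec w n) as [->|Hne].
      - rewrite Ht3; lia.
      - apply Ht2; lia. }
    (* The successor is there because only candidates strictly below [t] are tried. *)
    destruct (Hall v (le_n v)) as [t2 Ht2]. exists (S (v + t1 + t2)). intros t Ht.
    rewrite (search_complete _ t v); [reflexivity|apply Ht1; lia| |lia].
    intros w Hlt. apply Ht2; lia.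
Qed.

(** The arity is quantified inside the induction, because subprograms run on lists of other
    lengths. *)
Lemma simulation e : forall k, exists F, simulates k e F.
Proof.
  induction e as [| |i| |f gs IHf IHgs|f g IHf IHg|f IHf] using prog_list_ind; intros k.
  - exists (fun _ _ => 1). repeat split.
    + computable_basic.
    + intros t l v _ [= <-]. constructor.
    + intros l v _ He. inversion He; subst. now exists 0.
  - exists (fun _ l => S (S (nth 0 l 0))). repeat split.
    + do 2 apply computable_S. apply computable_tl_proj.
    + intros t l v _ [= <-]. replace (nth 0 l 0) with (hd 0 l) by now destruct l. constructor.
    + intros l v _ He. inversion He; subst. exists 0. now destruct l.
  - exists (fun _ l => S (nth i l 0)). repeat split.
    + apply computable_S, computable_tl_proj.
    + intros t l v _ [= <-]. constructor.
    + intros l v _ He. inversion He; subst. now exists 0.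
  (* [o0] always answers zero, so the simulation needs no oracle call. *)
  - exists (fun _ _ => 1). repeat split.
    + computable_basic.
    + intros t l v _ [= <-]. apply (ev_oracle o0).
    + intros l v _ He. inversion He; subst. now exists 0.
  - assert (HFs : exists Fs, Forall2 (simulates k) gs Fs).
    { clear -IHgs. induction IHgs as [|g gs Hg _ [Fs IH]]; [now exists []|].
      destruct (Hg k) as [F HF]. exists (F :: Fs). now constructor. }
    destruct HFs as [Fs HFs]. destruct (IHf (length gs)) as [Ff HFf].
    eexists. now apply simulates_comp; eauto.
  - destruct k as [|k].
    (* On the empty argument list a [PPrec] has no evaluation. *)
    + exists (fun _ _ => 0). repeat split.
      * computable_basic.
      * discriminate.
      * intros [|a l] v Hl He; [inversion He|discriminate Hl].
    + destruct (IHf k) as [Ff HFf]. destruct (IHg (S (S k))) as [Fg HFg].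
      eexists. now apply simulates_prec; eauto.
  - destruct (IHf (S k)) as [Ff HFf]. eexists. now apply simulates_mu; eauto.
Qed.

(** With enough fuel one simulating function shows both values. *)
Lemma eval_deterministic e l v v' : eval o0 e l v -> eval o0 e l v' -> v = v'.
Proof.
  intros H H'. destruct (simulation e (length l)) as [F [_ [_ Hc]]].
  destruct (Hc l v eq_refl H) as [t Ht]. destruct (Hc l v' eq_refl H') as [t' Ht'].
  specialize (Ht (t + t') ltac:(lia)). specialize (Ht' (t + t') ltac:(lia)). congruence.
Qed.

(** * Strings and their codes *)

Lemma prefix_length X n : length (prefix X n) = n.
Proof. induction n; simpl; [reflexivity|]. rewrite length_app. simpl. lia. Qed.

Lemma nth_prefix X n m : m < n -> nth m (prefix X n) false = X m.
Proof.
  induction n as [|n IH]; intros Hm; [lia|]. simpl.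
  destruct (Nat.eq_dec m n) as [->|Hne].
  - rewrite app_nth2 by (rewrite prefix_length; lia).
    now rewrite prefix_length, Nat.sub_diag.
  - rewrite app_nth1 by (rewrite prefix_length; lia). apply IH. lia.
Qed.

Lemma cyl_nth s X : cyl s X <-> forall m, m < length s -> X m = nth m s false.
Proof.
  unfold cyl. split.
  - intros H m Hm. rewrite <- H at 1. symmetry. now apply nth_prefix.
  - intros H. apply nth_ext with (d := false) (d' := false); [apply prefix_length|].
    intros m Hm. rewrite prefix_length in Hm. rewrite nth_prefix by exact Hm. now apply H.
Qed.

Lemma cyl_prefix X n Y : cyl (prefix X n) Y <-> forall m, m < n -> Y m = X m.
Proof.
  rewrite cyl_nth, prefix_length.
  split; intros H m Hm; specialize (H m Hm); now rewrite nth_prefix in * by exact Hm.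
Qed.

Lemma cyl_sub_prefix V X n : cyl_sub (prefix X n) V -> V X.
Proof. intros H. apply H. now apply cyl_prefix. Qed.

(** A code ends in a leading binary digit 1. Appending [b] puts [b] in its place and moves it up by
    one, which adds [b + 2 - 1] times its weight. *)
Lemma code_snoc s b : code (s ++ [b]) = code s + pow2 (length s) * S (if b then 1 else 0).
Proof.
  induction s as [|c s IH]; [destruct b; reflexivity|].
  change (pow2 (length (c :: s))) with (pow2 (length s) + pow2 (length s)).
  cbn [app code]. rewrite IH. destruct b, c; lia.
Qed.

Lemma code_pos s : 1 <= code s.
Proof. induction s; simpl; lia. Qed.

Lemma code_inj s t : code s = code t -> s = t.
Proof.
  revert t. induction s as [|b s IH]; intros [|c t] H; simpl in H.
  - reflexivity.
  - pose proof (code_pos t). lia.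
  - pose proof (code_pos s). lia.
  - assert (b = c) as -> by (destruct b, c; lia). f_equal. apply IH. lia.
Qed.

Lemma code_surj c : 1 <= c -> { s | code s = c }.
Proof.
  induction c as [c IH] using (well_founded_induction lt_wf). intros Hc.
  destruct (Nat.eq_dec c 1) as [->|Hne]; [now exists []|].
  destruct (IH (Nat.div2 c)) as [s Hs].
  - apply Nat.lt_div2. lia.
  - destruct c as [|[|c]]; [lia|lia|apply le_n_S, Nat.le_0_l].
  - exists (Nat.odd c :: s). simpl. rewrite Hs.
    pose proof (Nat.div2_odd c) as H. unfold Nat.b2n in H. lia.
Qed.

Definition decode (c : nat) : list bool :=
  match le_dec 1 c with
  | left H => proj1_sig (code_surj c H)
  | right _ => []
  end.

Lemma code_decode c : 1 <= c -> code (decode c) = c.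
Proof.
  intros Hc. unfold decode. destruct (le_dec 1 c) as [H|H]; [|contradiction].
  exact (proj2_sig (code_surj c H)).
Qed.

Lemma decode_code s : decode (code s) = s.
Proof. apply code_inj, code_decode, code_pos. Qed.

Lemma shift_S c j : shift c (S j) = half (shift c j).
Proof. reflexivity. Qed.

Lemma shift_code s j : j <= length s -> shift (code s) j = code (skipn j s).
Proof.
  induction j as [|j IH]; intros Hj; [reflexivity|].
  rewrite shift_S, IH by lia.
  destruct (skipn j s) as [|b r] eqn:E.
  - apply (f_equal (@length bool)) in E. rewrite length_skipn in E. simpl in E. lia.
  - replace (skipn (S j) s) with r.
    + apply half_spec with (b := if b then 1 else 0); [reflexivity|destruct b; lia].
    + change (S j) with (1 + j). rewrite <- skipn_skipn, E. reflexivity.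
Qed.

(** The leading 1 survives exactly [length s] halvings, so the length can be tested on the code. *)
Lemma shift_code_pos s j : shift (code s) j <> 0 <-> j <= length s.
Proof.
  split; intros H.
  - destruct (le_lt_dec j (length s)) as [Hle|Hlt]; [exact Hle|]. exfalso. apply H.
    clear H. induction Hlt as [|j _ IH].
    + rewrite shift_S, shift_code, skipn_all by lia. reflexivity.
    + rewrite shift_S, IH. reflexivity.
  - rewrite shift_code by exact H. pose proof (code_pos (skipn j s)). lia.
Qed.

Definition code_bit (c m : nat) : nat := parity (shift c m).

Lemma code_bit_code s m :
  m < length s -> code_bit (code s) m = if nth m s false then 1 else 0.
Proof.
  intros Hm. unfold code_bit. rewrite shift_code by lia.
  destruct (skipn m s) as [|b r] eqn:E.
  - apply (f_equal (@length bool)) in E. rewrite length_skipn in E. simpl in E. lia.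
  - replace (nth m s false) with b.
    + apply parity_spec with (a := code r); [reflexivity|destruct b; lia].
    + rewrite <- (Nat.add_0_r m), <- nth_skipn, E. reflexivity.
Qed.

Definition prefix_code (p : nat -> nat) (n : nat) : nat :=
  natrec 1 (fun m r => r + pow2 m * S (p m)) n.

Lemma prefix_code_spec p (X : cantor) n :
  (forall m, m < n -> p m = if X m then 1 else 0) -> prefix_code p n = code (prefix X n).
Proof.
  induction n as [|n IH]; intros H; [reflexivity|].
  change (prefix_code p (S n)) with (prefix_code p n + pow2 n * S (p n)).
  simpl prefix. rewrite code_snoc, prefix_length, IH, H; auto.
Qed.

Lemma prefix_code_bits s (X : cantor) n :
  n <= length s -> (forall m, m < n -> nth m s false = X m) ->
  prefix_code (code_bit (code s)) n = code (prefix X n).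
Proof.
  intros Hn H. apply prefix_code_spec. intros m Hm.
  rewrite code_bit_code, H by lia. reflexivity.
Qed.

Lemma computable_prefix_code k (p : Baire -> nat -> nat -> nat) A N :
  computable 2 (fun o l => p o (nth 0 l 0) (nth 1 l 0)) ->
  computable k A -> computable k N ->
  computable k (fun o l => prefix_code (p o (A o l)) (N o l)).
Proof.
  intros Hp.
  apply (computable_app2 k (fun o a n => prefix_code (p o a) n)).
  apply (computable_natrec 2 _ _ (fun o l m r => r + pow2 m * S (p o (nth 0 l 0) m))).
  - computable_basic.
  - computable_basic.
  - apply computable_add; [computable_basic|]. apply computable_mul.
    + apply computable_pow2. computable_basic.
    + apply computable_S. apply (computable_app2 4 p); [exact Hp| |]; computable_basic.
Qed.

Lemma computable_code_bit k C M :
  computable k C -> computable k M -> computable k (fun o l => code_bit (C o l) (M o l)).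
Proof. intros. now apply computable_parity, computable_shift. Qed.

(** * Computably enumerable families of strings *)

Lemma least_witness (P : nat -> Prop) :
  (exists n, P n) -> exists n, P n /\ forall m, m < n -> ~ P m.
Proof.
  intros [n Hn]. apply NNPP. intros Hno. revert Hn.
  induction n as [n IH] using (well_founded_induction lt_wf). intros Hn.
  apply Hno. exists n. split; [exact Hn|]. exact IH.
Qed.

Lemma ce2_intro S (D : nat -> nat -> nat -> nat) :
  computable 3 (fun _ l => D (nth 0 l 0) (nth 1 l 0) (nth 2 l 0)) ->
  (forall i s, S i s <-> exists t, D t i (code s) <> 0) -> ce2 S.
Proof.
  intros HD HS.
  assert (HD' : computable 3
    (fun _ l => ifz (D (nth 0 l 0) (nth 1 l 0) (nth 2 l 0)) 1 0)) by computable_basic.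
  destruct HD' as [e He]. exists (PMu e). intros i s. rewrite HS. split.
  - intros Hex. apply least_witness in Hex as [t [Ht Hmin]].
    exists t. constructor.
    + pose proof (He o0 [t; i; code s] eq_refl) as H. cbn in H.
      destruct (D t i (code s)); [contradiction|exact H].
    + intros w Hw. exists 0.
      pose proof (He o0 [w; i; code s] eq_refl) as H. cbn in H.
      destruct (D w i (code s)) eqn:E; [exact H|]. exfalso. apply (Hmin w Hw). now rewrite E.
  - intros [v Hv]. exists v. inversion Hv as [| | | | | | |? ? ? H0 _]; subst.
    pose proof (eval_deterministic _ _ _ _ H0 (He o0 [v; i; code s] eq_refl)) as H.
    cbn in H. intros E. rewrite E in H. discriminate H.
Qed.

(** The enumeration in stages: [D] is sound at every stage, and each member is confirmed at all late
    enough stages. [D] may be called with any oracle. *)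
Lemma ce2_elim S : ce2 S ->
  exists D, computable 3 (fun _ l => D (nth 0 l 0) (nth 1 l 0) (nth 2 l 0)) /\
    (forall t i s, D t i (code s) <> 0 -> S i s) /\
    (forall i s, S i s -> exists t0, forall t, t0 <= t -> D t i (code s) <> 0).
Proof.
  intros [e He]. destruct (simulation e 2) as [F [HF [Hs Hc]]].
  exists (fun t i c => F t [i; c]). split; [|split].
  - apply (computable_sim_comp 2 3 F (fun _ l => nth 0 l 0)
      [(fun _ l => nth 1 l 0); (fun _ l => nth 2 l 0)]); computable_basic; auto.
    repeat constructor; computable_basic.
  - intros t i s H. apply He. exists (pred (F t [i; code s])).
    apply (Hs t); [reflexivity|lia].
  - intros i s H. apply He in H as [v Hv].
    destruct (Hc [i; code s] v eq_refl Hv) as [t0 Ht0].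
    exists t0. intros t Ht. rewrite Ht0 by exact Ht. discriminate.
Qed.

(** * Prefix-free lists *)

Definition incomparable (s t : list bool) : Prop := ~ is_prefix s t /\ ~ is_prefix t s.

(** Replaces indices by a form that allows induction on the list and filtering. *)
Lemma prefix_free_pairs l : prefix_free l <-> ForallOrdPairs incomparable l.
Proof.
  induction l as [|s l IH].
  - split; [constructor|]. intros _ j k Hj. simpl in Hj. lia.
  - split.
    + intros H. constructor.
      * apply Forall_forall. intros t Ht. apply (In_nth l t []) in Ht as [k [Hk <-]].
        split; [apply (H 0 (S k))|apply (H (S k) 0)]; simpl; lia.
      * apply IH. intros j k Hj Hk Hjk. apply (H (S j) (S k)); simpl; lia.
    + intros H. inversion H as [|? ? Hs Hl]; subst.
      rewrite Forall_forall in Hs.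
      intros [|j] [|k] Hj Hk Hjk; simpl in *.
      * lia.
      * apply Hs, nth_In. lia.
      * apply Hs, nth_In. lia.
      * apply IH; [exact Hl|lia|lia|lia].
Qed.

Lemma ForallOrdPairs_filter {A} (R : A -> A -> Prop) f l :
  ForallOrdPairs R l -> ForallOrdPairs R (filter f l).
Proof.
  induction 1 as [|a l Ha _ IH]; simpl; [constructor|].
  destruct (f a); [|exact IH]. constructor; [|exact IH].
  apply Forall_forall. intros b Hb. apply filter_In in Hb as [Hb _].
  now apply (proj1 (Forall_forall _ _) Ha).
Qed.

Lemma strings_measure_filter f l :
  strings_measure l
  = (strings_measure (filter f l) + strings_measure (filter (fun s => negb (f s)) l))%R.
Proof.
  induction l as [|s l IH]; simpl; [lra|]. rewrite IH. destruct (f s); simpl; lra.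
Qed.

(** The Kraft inequality below the root [r], by induction on the depth [n]. Either [r] itself is
    listed and excludes all other strings, or the list splits by the bit that follows [r]. *)
Lemma kraft n r l :
  ForallOrdPairs incomparable l ->
  (forall s, In s l -> is_prefix r s /\ length s <= length r + n) ->
  (strings_measure l <= (/ 2) ^ length r)%R.
Proof.
  assert (Hpow : forall m, (0 <= (/ 2) ^ m)%R) by (intros m; apply pow_le; lra).
  revert r l. induction n as [|n IH]; intros r l Hl Hr.
  - destruct Hl as [|s l Hs Hl]; [apply Hpow|].
    assert (Heq : forall t, In t (s :: l) -> t = r).
    { intros t Ht. destruct (Hr t Ht) as [[u ->] Hlen]. rewrite length_app in Hlen.
      destruct u; [apply app_nil_r|simpl in Hlen; lia]. }
    destruct l as [|t l].
    + rewrite (Heq s) by now left. simpl. lra.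
    + exfalso. apply Forall_inv in Hs as [Hs _]. apply Hs.
      rewrite (Heq s), (Heq t) by (simpl; auto). exists []. now rewrite app_nil_r.
  - destruct (classic (In r l)) as [Hin|Hin].
    + assert (Heq : l = [r]).
      { destruct Hl as [|s l Hs Hl]; [destruct Hin|].
        rewrite Forall_forall in Hs. destruct Hin as [->|Hin].
        - destruct l as [|t l]; [reflexivity|]. exfalso.
          apply (proj1 (Hs t (or_introl eq_refl))). apply Hr. simpl; auto.
        - exfalso. apply (proj2 (Hs r Hin)). apply Hr. simpl; auto. }
      rewrite Heq. simpl. lra.
    + set (f := fun s : list bool => nth (length r) s false).
      assert (Hhalf : forall b s, In s l -> f s = b ->
        is_prefix (r ++ [b]) s /\ length s <= length (r ++ [b]) + n).
      { intros b s Hs Hb. destruct (Hr s Hs) as [[u ->] Hlen].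
        destruct u as [|c u]; [rewrite app_nil_r in Hs; contradiction|].
        unfold f in Hb. rewrite nth_middle in Hb. subst c.
        rewrite !length_app in *. simpl in *. split; [|lia].
        exists u. now rewrite <- app_assoc. }
      rewrite (strings_measure_filter f l).
      assert (H1 : (strings_measure (filter f l) <= (/ 2) ^ length (r ++ [true]))%R).
      { apply IH; [now apply ForallOrdPairs_filter|]. intros s Hs.
        apply filter_In in Hs as [Hs Hb]. now apply Hhalf. }
      assert (H2 : (strings_measure (filter (fun s => negb (f s)) l)
                    <= (/ 2) ^ length (r ++ [false]))%R).
      { apply IH; [now apply ForallOrdPairs_filter|]. intros s Hs.
        apply filter_In in Hs as [Hs Hb]. apply Bool.negb_true_iff in Hb. now apply Hhalf. }
      rewrite length_app, Nat.add_1_r in H1, H2. simpl in H1, H2. lra.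
Qed.

Lemma is_prefix_nth s t :
  length s <= length t -> (forall m, m < length s -> nth m t false = nth m s false) ->
  is_prefix s t.
Proof.
  revert t. induction s as [|b s IH]; intros t Hl H; [now exists t|].
  destruct t as [|c t]; [simpl in Hl; lia|].
  destruct (IH t) as [r ->]; [simpl in Hl; lia| |].
  - intros m Hm. apply (H (S m)). simpl. lia.
  - exists r. simpl. f_equal. apply (H 0). simpl. lia.
Qed.

(** * Computable sequences are not random *)

Lemma cyl_sub_cyl_prefix Y i s :
  cyl_sub s (cyl (prefix Y i)) <->
  i <= length s /\ forall m, m < i -> nth m s false = Y m.
Proof.
  split.
  - intros H.
    (* Beyond [s] this sequence disagrees with [Y] everywhere, which forces [i <= length s]. *)
    set (Z := fun m => if lt_dec m (length s) then nth m s false else negb (Y m)).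
    assert (HZ : cyl (prefix Y i) Z).
    { apply H, cyl_nth. intros m Hm. unfold Z.
      destruct (lt_dec m (length s)); [reflexivity|contradiction]. }
    rewrite cyl_prefix in HZ.
    assert (Hlt : forall m, m < i -> m < length s).
    { intros m Hm. specialize (HZ m Hm). unfold Z in HZ.
      destruct (lt_dec m (length s)); [assumption|]. now destruct (Y m). }
    split.
    + destruct i as [|i]; [lia|]. apply Hlt. lia.
    + intros m Hm. specialize (HZ m Hm). unfold Z in HZ.
      destruct (lt_dec m (length s)) as [_|Hn]; [exact HZ|]. now apply Hlt in Hm.
  - intros [Hi H] Z HZ. rewrite cyl_nth in HZ. apply cyl_prefix.
    intros m Hm. rewrite HZ by lia. now apply H.
Qed.

(** For these cylinders the c.e. condition is even decidable, by comparing the first [i] bits of [s]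
    with [Y]. The measure bound is [kraft] with root [prefix Y i]. *)
Lemma ML_test_computable (Y : cantor) (y : nat -> nat) :
  (forall m, y m = if Y m then 1 else 0) ->
  computable 1 (fun _ l => y (nth 0 l 0)) ->
  ML_test (fun i => cyl (prefix Y i)).
Proof.
  intros Hy Hc. split; [|split].
  - intros i X HX. exists i. intros Z HZ. rewrite cyl_prefix in *.
    intros m Hm. rewrite HZ by exact Hm. now apply HX.
  - pose (dist := fun a b => (a - b) + (b - a)).
    apply ce2_intro with (D := fun _ i c =>
      ifz (shift c i) 0 (ifz (dist (prefix_code (code_bit c) i) (prefix_code y i)) 1 0)).
    + apply computable_ifz; [apply computable_shift; computable_basic|computable_basic|].
      apply computable_ifz; [|computable_basic|computable_basic].
      assert (H1 : computable 3 (fun _ l => prefix_code (code_bit (nth 2 l 0)) (nth 1 l 0))).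
      { apply (computable_prefix_code 3 (fun _ => code_bit)); computable_basic.
        apply computable_code_bit; computable_basic. }
      assert (H2 : computable 3 (fun _ l => prefix_code y (nth 1 l 0))).
      { apply (computable_prefix_code 3 (fun _ _ => y) (fun _ _ => 0)); computable_basic.
        apply (computable_app1 2 (fun _ => y)); computable_basic. }
      unfold dist. computable_basic.
    + intros i s. rewrite cyl_sub_cyl_prefix, <- shift_code_pos.
      rewrite (prefix_code_spec y Y i) by auto. split.
      * intros [Hi H]. exists 0. rewrite prefix_code_bits with (X := Y) by
          (try apply shift_code_pos; assumption).
        unfold dist. rewrite Nat.sub_diag. destruct (shift (code s) i); [contradiction|].
        discriminate.
      * intros [_ H]. destruct (shift (code s) i) eqn:Ei; [contradiction|].
        split; [discriminate|].
        assert (Hi : i <= length s) by (apply shift_code_pos; lia).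
        assert (Hd : dist (prefix_code (code_bit (code s)) i) (code (prefix Y i)) = 0).
        { simpl in H. destruct (dist _ _); [reflexivity|contradiction]. }
        rewrite prefix_code_bits with (X := fun m => nth m s false) in Hd by auto.
        assert (He : prefix (fun m => nth m s false) i = prefix Y i)
          by (apply code_inj; unfold dist in Hd; lia).
        intros m Hm. rewrite <- (nth_prefix Y i m Hm), <- He. now rewrite nth_prefix.
  - intros i l Hl HV.
    assert (Hmax : exists n, forall s, In s l -> length s <= n).
    { clear. induction l as [|s l [n IH]]; [exists 0; intros s []|].
      exists (length s + n). intros t [<-|Ht]; [lia|]. specialize (IH t Ht). lia. }
    destruct Hmax as [n Hn]. rewrite <- (prefix_length Y i).
    apply (kraft n); [now apply prefix_free_pairs|].
    intros s Hs. specialize (Hn s Hs). split; [|lia].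
    apply HV, cyl_sub_cyl_prefix in Hs as [Hi H].
    apply is_prefix_nth; rewrite prefix_length; [exact Hi|].
    intros m Hm. rewrite nth_prefix by exact Hm. now apply H.
Qed.

(** The finitely many other values are built into the program one by one. *)
Lemma eventually_zero_computable a (y : nat -> nat) :
  (forall n, a <= n -> y n = 0) -> computable 1 (fun _ l => y (nth 0 l 0)).
Proof.
  revert y. induction a as [|a IH]; intros y Hy.
  - apply computable_ext with (F := fun _ _ => 0); [|computable_basic].
    intros o l _. symmetry. apply Hy. lia.
  - apply computable_ext with
      (F := fun _ l => ifz (nth 0 l 0) (y 0) (y (S (pred (nth 0 l 0))))).
    { intros o l _. now destruct (nth 0 l 0). }
    apply computable_ifz; [computable_basic|computable_basic|].
    apply (computable_app1 1 (fun _ n => y (S n))); [|computable_basic].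
    apply (IH (fun n => y (S n))). intros n Hn. apply Hy. lia.
Qed.

Lemma universal_eventually_false U Y a :
  universal_ML_test U -> (forall n, a <= n -> Y n = false) -> forall i, U i Y.
Proof.
  intros [_ HU] HY. apply (HU (fun i => cyl (prefix Y i))).
  - apply ML_test_computable with (y := fun n => if Y n then 1 else 0); [reflexivity|].
    apply (eventually_zero_computable a (fun n => if Y n then 1 else 0)). intros n Hn. now rewrite HY.
  - intros i. now apply cyl_prefix.
Qed.

(** * Randomness is invariant under finite changes *)

Fixpoint flip_string (k : nat) (s : list bool) {struct s} : list bool :=
  match s, k with
  | [], _ => []
  | b :: s', O => negb b :: s'
  | b :: s', S k' => b :: flip_string k' s'
  end.

Definition flip (k : nat) (X : cantor) : cantor :=
  fun n => if Nat.eqb n k then negb (X n) else X n.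

Lemma flip_string_length k s : length (flip_string k s) = length s.
Proof. revert k. induction s as [|b s IH]; intros [|k]; simpl; auto. Qed.

Lemma flip_string_involutive k s : flip_string k (flip_string k s) = s.
Proof.
  revert k. induction s as [|b s IH]; intros [|k]; simpl; f_equal; auto.
  apply Bool.negb_involutive.
Qed.

Lemma flip_involutive k X : flip k (flip k X) = X.
Proof.
  apply functional_extensionality. intros n. unfold flip.
  destruct (Nat.eqb n k); [apply Bool.negb_involutive|reflexivity].
Qed.

Lemma nth_flip_string k s m :
  m < length s ->
  nth m (flip_string k s) false = if Nat.eqb m k then negb (nth m s false) else nth m s false.
Proof.
  revert k m. induction s as [|b s IH]; intros [|k] [|m] Hm; simpl in *;
    try reflexivity; try lia. apply IH. lia.
Qed.

Lemma cyl_flip k s X : cyl (flip_string k s) (flip k X) <-> cyl s X.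
Proof.
  rewrite !cyl_nth, flip_string_length.
  split; intros H m Hm; specialize (H m Hm); rewrite nth_flip_string in * by exact Hm;
    unfold flip in *; destruct (Nat.eqb m k).
  - apply (f_equal negb) in H. now rewrite !Bool.negb_involutive in H.
  - exact H.
  - now rewrite H.
  - exact H.
Qed.

Lemma cyl_sub_flip k s (V : cantor -> Prop) :
  cyl_sub s (fun X => V (flip k X)) <-> cyl_sub (flip_string k s) V.
Proof.
  split; intros H Y HY.
  - rewrite <- (flip_involutive k Y) in *. apply H. now apply cyl_flip in HY.
  - apply H. now apply cyl_flip.
Qed.

Lemma is_prefix_flip_string k s t :
  is_prefix (flip_string k s) (flip_string k t) -> is_prefix s t.
Proof.
  assert (Hmono : forall s t, is_prefix s t -> is_prefix (flip_string k s) (flip_string k t)).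
  { clear. intros s t [r ->]. revert k. induction s as [|b s IH]; intros k.
    - now exists (flip_string k r).
    - destruct k as [|k]; simpl.
      + now exists r.
      + destruct (IH k) as [u Hu]. exists u. simpl. now rewrite Hu. }
  intros H. apply Hmono in H. now rewrite !flip_string_involutive in H.
Qed.

(** Recursion outside the programs is enough, as [k] is a constant of the program. The test on
    [pred c] catches the code [1] of the empty string, which has no bit to flip. *)
Fixpoint flip_code (k c : nat) : nat :=
  match k with
  | O => ifz (pred c) c (ifz (parity c) (S c) (pred c))
  | S k' => ifz (pred c) c (flip_code k' (half c) + flip_code k' (half c) + parity c)
  end.

Lemma flip_code_spec k s : flip_code k (code s) = code (flip_string k s).
Proof.
  revert k. induction s as [|b s IH]; intros [|k]; try reflexivity;
    pose proof (code_pos s) as Hs;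
    assert (Hp : parity (code (b :: s)) = if b then 1 else 0)
      by (apply parity_spec with (a := code s); [reflexivity|destruct b; lia]);
    assert (Hh : half (code (b :: s)) = code s)
      by (apply half_spec with (b := if b then 1 else 0); [reflexivity|destruct b; lia]);
    cbn [flip_code flip_string]; rewrite Hp, ?Hh, ?IH;
    assert (Hpos : pred (code (b :: s)) <> 0) by (simpl; destruct b; lia);
    destruct (pred (code (b :: s))) eqn:E; try contradiction; cbn [ifz].
  - destruct b; cbn [ifz code negb] in *; lia.
  - cbn [code]. lia.
Qed.

Lemma computable_flip_code j k C :
  computable j C -> computable j (fun o l => flip_code k (C o l)).
Proof.
  revert C. induction k as [|k IH]; intros C HC; simpl.
  - apply computable_ifz; [computable_basic|computable_basic|].
    apply computable_ifz; [now apply computable_parity|computable_basic|computable_basic].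
  - apply computable_ifz; [computable_basic|computable_basic|].
    apply computable_add; [apply computable_add; now apply IH, computable_half|].
    now apply computable_parity.
Qed.

Lemma strings_measure_flip k l :
  strings_measure (map (flip_string k) l) = strings_measure l.
Proof. induction l as [|s l IH]; simpl; [reflexivity|]. now rewrite IH, flip_string_length. Qed.

(** A flip is an involution that maps cylinders to cylinders of the same length, and it acts
    computably on their codes. *)
Lemma ML_test_flip k V : ML_test V -> ML_test (fun i X => V i (flip k X)).
Proof.
  intros [Hopen [Hce Hm]]. split; [|split].
  - intros i X HX. destruct (Hopen i _ HX) as [n Hn]. exists n.
    intros Y HY. apply Hn. rewrite cyl_prefix in *. intros m Hlt. unfold flip.
    now rewrite HY.
  - destruct (ce2_elim _ Hce) as [D [HD [Hs Hc]]].
    apply ce2_intro with (D := fun t i c => D t i (flip_code k c)).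
    + apply (computable_app3 3 (fun _ t i c => D t i c)); [exact HD| | |];
        [computable_basic|computable_basic|apply computable_flip_code; computable_basic].
    + intros i s. rewrite cyl_sub_flip, flip_code_spec. split.
      * intros H. destruct (Hc _ _ H) as [t Ht]. exists t. now apply Ht.
      * intros [t Ht]. exact (Hs _ _ _ Ht).
  - intros i l Hl HV. rewrite <- (strings_measure_flip k). apply Hm.
    + intros j1 j2 H1 H2 Hne. rewrite length_map in H1, H2.
      change (@nil bool) with (flip_string k []). rewrite !map_nth.
      intros H. apply is_prefix_flip_string in H. exact (Hl j1 j2 H1 H2 Hne H).
    + intros s Hs. apply in_map_iff in Hs as [t [<- Ht]]. apply cyl_sub_flip, HV, Ht.
Qed.

Lemma MLR_flip k X : MLR X -> MLR (flip k X).
Proof. intros H V HV. exact (H _ (ML_test_flip k V HV)). Qed.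

(** The differing bits are repaired by single flips, from the highest position downwards. *)
Lemma MLR_finite_change N X Y : (forall n, N <= n -> Y n = X n) -> MLR X -> MLR Y.
Proof.
  revert X. induction N as [|N IH]; intros X H HX.
  - replace Y with X; [exact HX|]. apply functional_extensionality. intros n.
    symmetry. apply H. lia.
  - destruct (Bool.bool_dec (Y N) (X N)) as [E|E].
    + apply (IH X); [|exact HX]. intros n Hn.
      destruct (Nat.eq_dec n N) as [->|Hne]; [exact E|]. apply H. lia.
    + apply (IH (flip N X)); [|now apply MLR_flip]. intros n Hn. unfold flip.
      destruct (Nat.eqb_spec n N) as [->|Hne]; [now destruct (Y N), (X N)|]. apply H. lia.
Qed.

(** * Deciding trees relative to every oracle *)

(** Searches for an amount of fuel with which the simulation answers; since [f] is total, the search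
    ends. *)
Lemma computable_of_eval k e f :
  (forall l, length l = k -> eval o0 e l (f l)) -> computable k (fun _ l => f l).
Proof.
  intros He. destruct (simulation e k) as [F [HF [Hs Hc]]].
  assert (H1 : computable (S k) (fun _ l => ifz (F (nth 0 l 0) (tl l)) 1 0)) by computable_basic.
  assert (H2 : computable (S k) (fun _ l => pred (F (nth 0 l 0) (tl l)))) by computable_basic.
  destruct H1 as [e1 He1], H2 as [e2 He2], (evals_args k) as [es Hes].
  exists (PComp e2 (PMu e1 :: es)). intros o l Hl.
  assert (Hex : exists t, F t l <> 0).
  { destruct (Hc l (f l) Hl (He l Hl)) as [t Ht]. exists t. now rewrite Ht. }
  apply least_witness in Hex as [t [Ht Hmin]].
  assert (Hlen : forall w, length (w :: l) = S k) by (intros w; simpl; now rewrite Hl).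
  apply ev_comp with (ys := t :: l).
  - constructor; [|now apply Hes]. constructor.
    + pose proof (He1 o (t :: l) (Hlen t)) as H. cbn in H.
      destruct (F t l); [contradiction|exact H].
    + intros w Hw. exists 0. pose proof (He1 o (w :: l) (Hlen w)) as H. cbn in H.
      destruct (F w l) eqn:E; [exact H|]. exfalso. apply (Hmin w Hw). now rewrite E.
  - replace (f l) with (pred (F t l)); [exact (He2 o (t :: l) (Hlen t))|].
    apply (eval_deterministic e l); [|now apply He]. apply (Hs t); [exact Hl|lia].
Qed.

Lemma Sigma02_decider A :
  Sigma02 A -> exists (T : nat -> list bool -> bool) (F : nat -> nat -> nat),
    computable 2 (fun _ l => F (nth 0 l 0) (nth 1 l 0)) /\
    (forall i s, F i (code s) = if T i s then 1 else 0) /\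
    (forall i s t, T i t = true -> is_prefix s t -> T i s = true) /\
    (forall X, A X <-> exists i, paths (T i) X).
Proof.
  intros [T [[e He] [Htree HA]]].
  (* The given program is specified on codes only. The number [0] is not a code and is treated as
     [1], the code of the empty string. *)
  exists T, (fun i c => if T i (decode (ifz c 1 c)) then 1 else 0).
  split; [|split; [|split; assumption]].
  - assert (Hc : computable 2 (fun _ l => ifz (nth 1 l 0) 1 (nth 1 l 0))) by computable_basic.
    destruct Hc as [ec Hec].
    apply (computable_of_eval 2 (PComp e [PProj 0; ec])
      (fun l => if T (nth 0 l 0) (decode (ifz (nth 1 l 0) 1 (nth 1 l 0))) then 1 else 0)).
    intros l Hl. econstructor.
    + constructor; [constructor|]. constructor; [now apply Hec|constructor].
    + rewrite <- (code_decode (ifz (nth 1 l 0) 1 (nth 1 l 0))) at 1; [apply He|].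
      destruct (nth 1 l 0); simpl; lia.
  - intros i s. replace (ifz (code s) 1 (code s)) with (code s).
    + now rewrite decode_code.
    + pose proof (code_pos s). destruct (code s); [lia|reflexivity].
Qed.

(** * The reduction *)

Definition dies (R : nat -> nat -> nat) (p : Baire) (m s : nat) : Prop :=
  R m (prefix_code p s) = 0.

(* The index considered at stage [s]: it moves on as soon as the sequence is seen to leave the [m]-th closed set, whose tree is decided by [R m]. *)
Definition guess (R : nat -> nat -> nat) (p : Baire) (s : nat) : nat :=
  natrec 0 (fun s m => ifz (R m (prefix_code p s)) (S m) m) s.

(* The last stage below [n] at which the guess changes, plus one ([0] if there is none). *)
Definition last_change (R : nat -> nat -> nat) (p : Baire) (n : nat) : nat :=
  natrec 0 (fun s r => ifz (R (guess R p s) (prefix_code p s)) (S s) r) n.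

(** All initial segments up to length [n] are tried: a fixed one inside [U k] is confirmed at all
    late stages, while the one of length [n] might never be confirmed at stage [n]. *)
Definition seen (D : nat -> nat -> nat -> nat) (k c n : nat) : nat :=
  bex (fun j => D n k (prefix_code (code_bit c) j)) (S n).

(** [L] will be the stage of the last change plus one, so [k < L] covers that stage too. *)
Definition pending (D : nat -> nat -> nat -> nat) (L c n : nat) : nat :=
  bex (fun k => ifz (seen D k c n) 1 0) L.

(** Each output bit depends on all earlier ones. Carrying their code as the recursion value makes
    this a primitive recursion. *)
Definition damaged_code (R : nat -> nat -> nat) (D : nat -> nat -> nat -> nat) (p : Baire)
    (n : nat) : nat :=
  natrec 1 (fun m c => c + pow2 m * S (ifz (pending D (last_change R p m) c m) (p m) 0)) n.

(* The input sequence, overwritten by zeros as long as the output is not yet seen to lie in [U k] for every [k] up to the last stage at which the guess changed. *)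
Definition damaged (R : nat -> nat -> nat) (D : nat -> nat -> nat -> nat) (p : Baire) : Baire :=
  fun n => ifz (pending D (last_change R p n) (damaged_code R D p n) n) (p n) 0.

Lemma damaged_code_prefix R D p n : damaged_code R D p n = prefix_code (damaged R D p) n.
Proof.
  induction n as [|n IH]; [reflexivity|].
  change (prefix_code (damaged R D p) (S n))
    with (prefix_code (damaged R D p) n + pow2 n * S (damaged R D p n)).
  rewrite <- IH. reflexivity.
Qed.

(** [acc] tells how the input is read off the oracle: directly in the first reduction, from the even
    positions of the pair in the second. *)
Lemma computable_guess R (acc : Baire -> Baire) k N :
  computable 2 (fun _ l => R (nth 0 l 0) (nth 1 l 0)) ->
  computable 1 (fun o l => acc o (nth 0 l 0)) ->
  computable k N -> computable k (fun o l => guess R (acc o) (N o l)).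
Proof.
  intros HR Hacc. apply (computable_app1 k (fun o n => guess R (acc o) n)).
  apply (computable_natrec 1 _ _ (fun o _ s m => ifz (R m (prefix_code (acc o) s)) (S m) m));
    computable_basic.
  apply (computable_app2 3 (fun _ => R)); [exact HR|computable_basic|].
  apply (computable_prefix_code 3 (fun o _ => acc o) (fun _ _ => 0)); computable_basic.
  apply (computable_app1 2 acc); computable_basic.
Qed.

Lemma computable_last_change R k N :
  computable 2 (fun _ l => R (nth 0 l 0) (nth 1 l 0)) ->
  computable k N -> computable k (fun o l => last_change R o (N o l)).
Proof.
  intros HR. apply (computable_app1 k (last_change R)).
  apply (computable_natrec 1 _ _
    (fun o _ s r => ifz (R (guess R o s) (prefix_code o s)) (S s) r)); computable_basic.
  apply (computable_app2 3 (fun _ => R)); [exact HR| |].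
  - apply (computable_guess R (fun o => o)); computable_basic.
    apply computable_oracle; computable_basic.
  - apply (computable_prefix_code 3 (fun o _ => o) (fun _ _ => 0)); computable_basic.
    apply computable_oracle; computable_basic.
Qed.

Lemma computable_pending D k L C N :
  computable 3 (fun _ l => D (nth 0 l 0) (nth 1 l 0) (nth 2 l 0)) ->
  computable k L -> computable k C -> computable k N ->
  computable k (fun o l => pending D (L o l) (C o l) (N o l)).
Proof.
  intros HD. apply (computable_app3 k (fun _ => pending D)).
  apply (computable_bex 3 _
    (fun _ l k => ifz (seen D k (nth 1 l 0) (nth 2 l 0)) 1 0)); computable_basic.
  apply (computable_app3 5 (fun _ => seen D)); computable_basic.
  apply (computable_bex 3 _
    (fun _ l j => D (nth 2 l 0) (nth 0 l 0) (prefix_code (code_bit (nth 1 l 0)) j)));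
    computable_basic.
  apply (computable_app3 5 (fun _ => D)); [exact HD| | |]; computable_basic.
  apply (computable_prefix_code 5 (fun _ => code_bit)); computable_basic.
  apply computable_code_bit; computable_basic.
Qed.

Lemma computable_damaged R D :
  computable 2 (fun _ l => R (nth 0 l 0) (nth 1 l 0)) ->
  computable 3 (fun _ l => D (nth 0 l 0) (nth 1 l 0) (nth 2 l 0)) ->
  computable 1 (fun o l => damaged R D o (nth 0 l 0)).
Proof.
  intros HR HD.
  assert (Hcode : computable 1 (fun o l => damaged_code R D o (nth 0 l 0))).
  { apply (computable_natrec 1 _ _ (fun o _ m c =>
      c + pow2 m * S (ifz (pending D (last_change R o m) c m) (o m) 0))); computable_basic.
    - apply computable_pow2; computable_basic.
    - apply computable_pending; computable_basic.
      apply computable_last_change; computable_basic.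
    - apply computable_oracle; computable_basic. }
  apply computable_ifz; computable_basic.
  - apply computable_pending; computable_basic.
    apply computable_last_change; computable_basic.
  - apply computable_oracle; computable_basic.
Qed.

Lemma guess_S R p s :
  guess R p (S s) = ifz (R (guess R p s) (prefix_code p s)) (S (guess R p s)) (guess R p s).
Proof. reflexivity. Qed.

Lemma guess_mono R p s t : s <= t -> guess R p s <= guess R p t.
Proof.
  induction 1 as [|t _ IH]; [lia|]. rewrite guess_S.
  destruct (R (guess R p t) (prefix_code p t)); simpl; lia.
Qed.

Lemma guess_le R p m : (forall s, ~ dies R p m s) -> forall s, guess R p s <= m.
Proof.
  intros Hm. induction s as [|s IH]; [cbn; lia|]. rewrite guess_S.
  destruct (R (guess R p s) (prefix_code p s)) eqn:E; simpl; [|lia].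
  assert (guess R p s <> m) by (intros Heq; rewrite Heq in E; exact (Hm s E)). lia.
Qed.

(** Every change raises the guess, and it never passes an index that survives for ever. *)
Lemma guess_stabilizes R p m :
  (forall s, ~ dies R p m s) -> exists N, forall s, N <= s -> ~ dies R p (guess R p s) s.
Proof.
  intros Hm.
  (* Here [d] exceeds the number of changes that are still possible after stage [s0]. *)
  assert (H : forall d s0, m < guess R p s0 + d ->
    exists N, forall s, N <= s -> ~ dies R p (guess R p s) s).
  { induction d as [|d IH]; intros s0 Hd.
    - pose proof (guess_le R p m Hm s0). lia.
    - destruct (classic (exists s, s0 <= s /\ dies R p (guess R p s) s)) as [[s [Hs Hdead]]|Hno].
      + apply (IH (S s)). rewrite guess_S. unfold dies in Hdead. rewrite Hdead. simpl.
        pose proof (guess_mono R p s0 s Hs). lia.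
      + exists s0. intros s Hs Hdead. apply Hno. now exists s. }
  apply (H (S m) 0). lia.
Qed.

Lemma guess_const R p i :
  (forall s, i <= s -> ~ dies R p (guess R p s) s) ->
  forall s, i <= s -> guess R p s = guess R p i.
Proof.
  intros H s Hs. induction Hs as [|s Hs IH]; [reflexivity|]. rewrite guess_S.
  specialize (H s Hs). unfold dies in H.
  destruct (R (guess R p s) (prefix_code p s)); [contradiction|exact IH].
Qed.

Lemma last_change_S R p n :
  last_change R p (S n)
  = ifz (R (guess R p n) (prefix_code p n)) (S n) (last_change R p n).
Proof. reflexivity. Qed.

Lemma last_change_gt R p s n : dies R p (guess R p s) s -> s < n -> s < last_change R p n.
Proof.
  intros Hdead Hn. induction Hn as [|n Hn IH]; rewrite last_change_S.
  - unfold dies in Hdead. rewrite Hdead. simpl. lia.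
  - destruct (R (guess R p n) (prefix_code p n)); simpl; lia.
Qed.

Lemma last_change_const R p N n :
  (forall s, N <= s -> ~ dies R p (guess R p s) s) -> N <= n ->
  last_change R p n = last_change R p N.
Proof.
  intros H Hn. induction Hn as [|n Hn IH]; [reflexivity|]. rewrite last_change_S.
  specialize (H n Hn). unfold dies in H.
  destruct (R (guess R p n) (prefix_code p n)); [contradiction|exact IH].
Qed.

Lemma pending_spec D L (Y : cantor) n :
  pending D L (code (prefix Y n)) n = 0 <->
  forall k, k < L -> exists j, j <= n /\ D n k (code (prefix Y j)) <> 0.
Proof.
  assert (Hseen : forall k, seen D k (code (prefix Y n)) n <> 0 <->
    exists j, j <= n /\ D n k (code (prefix Y j)) <> 0).
  { intros k. unfold seen. rewrite bex_spec.
    split; intros [j [Hj H]]; exists j; (split; [lia|]);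
      rewrite prefix_code_bits with (X := Y) in *;
      try exact H; try (rewrite prefix_length; lia);
      intros m Hm; apply nth_prefix; lia. }
  split.
  - intros H k Hk. apply Hseen. intros E. revert H. apply bex_spec.
    exists k. split; [exact Hk|]. now rewrite E.
  - intros H. destruct (pending D L (code (prefix Y n)) n) eqn:E; [reflexivity|].
    assert (E' : pending D L (code (prefix Y n)) n <> 0) by now rewrite E.
    apply bex_spec in E' as [k [Hk Hne]]. apply H, Hseen in Hk.
    destruct (seen D k (code (prefix Y n)) n); contradiction.
Qed.

(** For each [k] openness gives an initial segment inside [U k], which the enumeration confirms from
    some stage on; finitely many [k] have a common bound. *)
Lemma eventually_not_pending (U : nat -> cantor -> Prop) D (Y : cantor) L :
  (forall i, Defs.open_set (U i)) ->
  (forall i s, cyl_sub s (U i) -> exists t0, forall t, t0 <= t -> D t i (code s) <> 0) ->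
  (forall k, k < L -> U k Y) ->
  exists n0, forall n, n0 <= n -> pending D L (code (prefix Y n)) n = 0.
Proof.
  intros Hopen Hc HU.
  assert (H : exists n0, forall n, n0 <= n ->
    forall k, k < L -> exists j, j <= n /\ D n k (code (prefix Y j)) <> 0).
  { induction L as [|L IH]; [exists 0; intros; lia|].
    destruct IH as [n1 Hn1]; [auto|].
    destruct (Hopen L Y (HU L ltac:(lia))) as [j Hj].
    destruct (Hc _ _ Hj) as [t0 Ht0].
    exists (n1 + j + t0). intros n Hn k Hk. destruct (Nat.eq_dec k L) as [->|Hne].
    - exists j. split; [lia|]. apply Ht0. lia.
    - apply Hn1; lia. }
  destruct H as [n0 H]. exists n0. intros n Hn. apply pending_spec. now apply H.
Qed.

Lemma damaged_spec U D R (X Y : cantor) (p : Baire) m :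
  universal_ML_test U ->
  (forall t i s, D t i (code s) <> 0 -> cyl_sub s (U i)) ->
  (forall i s, cyl_sub s (U i) -> exists t0, forall t, t0 <= t -> D t i (code s) <> 0) ->
  MLR X -> (forall n, p n = if X n then 1 else 0) ->
  (forall n, damaged R D p n = if Y n then 1 else 0) ->
  (forall s, ~ dies R p m s) ->
  MLR Y /\ forall i, ~ U i Y -> forall s, i <= s -> ~ dies R p (guess R p s) s.
Proof.
  intros HU Hs Hc HX Hp HY Hm.
  destruct (guess_stabilizes R p m Hm) as [N HN].
  set (L := last_change R p N).
  assert (Hcode : forall n, damaged_code R D p n = code (prefix Y n)).
  { intros n. rewrite damaged_code_prefix. now apply prefix_code_spec. }
  assert (Hpend : forall n, N <= n ->
    damaged R D p n = ifz (pending D L (code (prefix Y n)) n) (p n) 0).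
  { intros n Hn. unfold damaged. rewrite Hcode.
    now rewrite (last_change_const R p N n HN Hn). }
  assert (HUY : forall k, k < L -> U k Y).
  { apply NNPP. intros Hno.
    assert (Hall : forall n, pending D L (code (prefix Y n)) n <> 0).
    { intros n E. apply Hno. intros k Hk.
      destruct (proj1 (pending_spec D L Y n) E k Hk) as [j [_ Hj]].
      apply Hs in Hj. now apply cyl_sub_prefix in Hj. }
    apply Hno. intros k _. apply (universal_eventually_false U Y N HU).
    intros n Hn. specialize (HY n). rewrite Hpend in HY by exact Hn.
    specialize (Hall n). destruct (pending D L (code (prefix Y n)) n); [contradiction|].
    destruct (Y n); [discriminate HY|reflexivity]. }
  split.
  - destruct (eventually_not_pending U D Y L) as [n0 Hn0];
      [exact (proj1 (proj1 HU))|exact Hc|exact HUY|].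
    (* From here on [L] is final and nothing is pending, so the bits of [X] are copied. *)
    apply (MLR_finite_change (N + n0) X); [|exact HX]. intros n Hn.
    specialize (HY n). rewrite Hpend, Hn0, Hp in HY by lia. simpl in HY.
    now destruct (X n), (Y n).
  (* A change at stage [s >= i] would give [i <= s < L], hence [Y] in [U i]. *)
  - intros i Hi s His Hdead. apply Hi, HUY. apply Nat.le_lt_trans with s; [exact His|].
    apply last_change_gt; [exact Hdead|].
    destruct (le_lt_dec N s) as [Hle|Hlt]; [|exact Hlt]. exfalso. exact (HN s Hle Hdead).
Qed.

(** * Decoding the answer and putting the reduction together *)

Lemma is_prefix_prefix X n m : n <= m -> is_prefix (prefix X n) (prefix X m).
Proof.
  intros Hnm. apply is_prefix_nth; rewrite !prefix_length; [exact Hnm|].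
  intros j Hj. rewrite !nth_prefix by lia. reflexivity.
Qed.

(** The final guess is known to survive only from stage [i] on; closure of the tree under initial
    segments supplies the shorter ones. *)
Lemma paths_of_tail (T : list bool -> bool) X i :
  (forall s t, T t = true -> is_prefix s t -> T s = true) ->
  (forall s, i <= s -> T (prefix X s) = true) -> paths T X.
Proof.
  intros Htree H n. apply Htree with (t := prefix X (i + n)); [apply H; lia|].
  apply is_prefix_prefix. lia.
Qed.

Definition evens (o : Baire) : Baire := fun n => o (n + n).

Lemma evens_pairB p r : evens (pairB p r) = p.
Proof.
  apply functional_extensionality. intros n. unfold evens, pairB.
  replace (n + n) with (2 * n) by lia. now rewrite Nat.even_even, Nat.div2_double.
Qed.

Lemma pairB_odd p r n : pairB p r (S (n + n)) = r n.
Proof.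
  unfold pairB. replace (S (n + n)) with (S (2 * n)) by lia.
  now rewrite Nat.even_succ, Nat.odd_even, Nat.div2_succ_double.
Qed.

Lemma computable_evens k F : computable k F -> computable k (fun o l => evens o (F o l)).
Proof. intros HF. apply computable_oracle. computable_basic. Qed.

(** The answer [i] arrives as a characteristic function on the odd positions. It is recovered by
    searching for the only 1, with the values negated because [PMu] looks for a zero. *)
Lemma TF_from_singleton (f : Baire -> nat -> nat) :
  computable 1 (fun o l => f (evens o) (nth 0 l 0)) ->
  exists e, forall p i, TF e (pairB p (chi_singleton i)) (chi_singleton (f p i)).
Proof.
  intros Hf.
  assert (H1 : computable 2 (fun o l => ifz (o (S (nth 0 l 0 + nth 0 l 0))) 1 0)).
  { computable_basic. apply computable_oracle. computable_basic. }
  assert (H2 : computable 2 (fun o l =>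
    ifz ((nth 1 l 0 - f (evens o) (nth 0 l 0)) + (f (evens o) (nth 0 l 0) - nth 1 l 0)) 1 0)).
  { computable_basic; apply (computable_app1 2 (fun o => f (evens o))); computable_basic. }
  destruct H1 as [e1 He1], H2 as [e2 He2].
  exists (PComp e2 [PMu e1; PProj 0]). intros p i n.
  apply ev_comp with (ys := [i; n]).
  - constructor; [|constructor; constructor]. constructor.
    + pose proof (He1 (pairB p (chi_singleton i)) [i; n] eq_refl) as H. simpl nth in H.
      rewrite pairB_odd in H. unfold chi_singleton in H at 2. now rewrite Nat.eqb_refl in H.
    + intros w Hw. exists 0.
      pose proof (He1 (pairB p (chi_singleton i)) [w; n] eq_refl) as H. simpl nth in H.
      rewrite pairB_odd in H. unfold chi_singleton in H at 2.
      now rewrite (proj2 (Nat.eqb_neq w i)) in H by lia.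
  - pose proof (He2 (pairB p (chi_singleton i)) [i; n] eq_refl) as H. simpl nth in H.
    rewrite evens_pairB in H. unfold chi_singleton at 2.
    destruct (Nat.eqb_spec n (f p i)) as [E|E].
    + rewrite E, Nat.sub_diag in H. rewrite E. exact H.
    + destruct (n - f p i + (f p i - n)) eqn:Ed; [lia|exact H].
Qed.

Theorem theorem5p14 :
  forall (U : nat -> cantor -> Prop), universal_ML_test U ->
  forall (A : cantor -> Prop), Delta02 A ->
  weihrauch_le delta_MLR delta_nat delta_MLR delta_nat (chi_MLR A) (LAY U).
Proof.
  intros U HU A [HA HcoA].
  destruct (Sigma02_decider _ HA) as [T [FT [HFT [HT [Ttree HTA]]]]].
  destruct (Sigma02_decider _ HcoA) as [S [FS [HFS [HS [Stree HSA]]]]].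
  destruct (ce2_elim _ (proj1 (proj2 (proj1 HU)))) as [D [HD [HDs HDc]]].
  set (R := fun m c => ifz (parity m) (FT (half m) c) (FS (half m) c)).
  assert (HR : computable 2 (fun _ l => R (nth 0 l 0) (nth 1 l 0))).
  { apply computable_ifz.
    - apply computable_parity. computable_basic.
    - apply (computable_app2 2 (fun _ => FT)); computable_basic.
      apply computable_half. computable_basic.
    - apply (computable_app2 2 (fun _ => FS)); computable_basic.
      apply computable_half. computable_basic. }
  destruct (computable_damaged R D HR HD) as [ePhi HePhi].
  (* Even indices belong to [A], where the characteristic function has the value 1. *)
  destruct (TF_from_singleton (fun p i => 1 - parity (guess R p i))) as [ePsi HePsi].
  { computable_basic. apply computable_parity.
    apply (computable_guess R evens); computable_basic.
    apply computable_evens. computable_basic. }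
  exists ePhi, ePsi. intros G HG p X [_ [Hp HX]] _.
  assert (Hcode : forall s, prefix_code p s = code (prefix X s)).
  { intros s. now apply prefix_code_spec. }
  (* The classical case distinction enters the verification only, not the programs. *)
  assert (Hlim : exists m, forall s, ~ dies R p m s).
  { unfold dies. destruct (classic (A X)) as [HAX|HAX].
    - apply HTA in HAX as [i Hi]. exists (2 * i + 0). intros s. unfold R.
      rewrite (parity_spec _ i 0), (half_spec _ i 0), Hcode by lia.
      simpl. now rewrite HT, Hi.
    - apply (HSA X) in HAX as [i Hi]. exists (2 * i + 1). intros s. unfold R.
      rewrite (parity_spec _ i 1), (half_spec _ i 1), Hcode by lia.
      simpl. now rewrite HS, Hi. }
  destruct Hlim as [m Hm].
  set (q := damaged R D p). set (Y := fun n => Nat.eqb (q n) 1).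
  assert (HY : forall n, q n = if Y n then 1 else 0).
  { intros n. unfold Y, q, damaged. rewrite Hp.
    destruct (pending _ _ _ _); simpl; [now destruct (X n)|reflexivity]. }
  destruct (damaged_spec U D R X Y p m HU HDs HDc HX Hp HY Hm) as [HYr Hstable].
  destruct (HG q Y) as [r [i [Hr [-> [_ Hi]]]]].
  { split; [|split; [exact HY|exact HYr]]. intros n. rewrite HY. destruct (Y n); lia. }
  (* Randomness of [Y], applied to the test [U] itself, shows that the query has an answer. *)
  { destruct (HYr U (proj1 HU)) as [i Hi]. exists i. now split. }
  specialize (Hstable i Hi). pose proof (guess_const R p i Hstable) as Hconst.
  exists q, (chi_singleton i), (chi_singleton (1 - parity (guess R p i))),
    (1 - parity (guess R p i)).
  split; [|split; [exact Hr|split; [apply HePsi|split; [reflexivity|]]]].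
  - intros n. exact (HePhi p [n] eq_refl).
  - split; [exact HX|]. set (g := guess R p i) in *.
    (* The guess at stage [i] is final, so its tree contains all long initial segments of [X]. *)
    assert (Halive : forall s, i <= s -> R g (code (prefix X s)) <> 0).
    { intros s His H. apply (Hstable s His). unfold dies. now rewrite Hconst, Hcode. }
    unfold R in Halive. destruct (parity g) as [|b] eqn:E.
    + left. split; [|reflexivity]. apply HTA. exists (half g).
      apply (paths_of_tail _ X i (Ttree (half g))). intros s His.
      specialize (Halive s His). simpl in Halive. rewrite HT in Halive.
      now destruct (T (half g) (prefix X s)).
    + right. split; [|reflexivity]. apply (HSA X). exists (half g).
      apply (paths_of_tail _ X i (Stree (half g))). intros s His.
      specialize (Halive s His). simpl in Halive. rewrite HS in Halive.
      now destruct (S (half g) (prefix X s)).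
Qed.
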